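(* For every abelian group $\mathbb{X}$ of (finite) order $n\ge 2$, the group $\mathbb{G}_{\mathbb{X}}$ of the automaton $\mathcal{A}_{\mathbb{X}}$ is isomorphic to the lamplighter group $\mathbb{X}\wr\mathbb{Z}$.
   Context: Let $\mathbb{X}$ be an additively written finite abelian group of order $n\ge 2$, and let $\mathbb{X}^*$ be the set of all finite words over the alphabet $\mathbb{X}$, including the empty word $\Lambda$. The automaton $\mathcal{A}_{\mathbb{X}}$ over the alphabet $\mathbb{X}$ has set of states $Q_{\mathbb{X}}=\{a_i : i\in\mathbb{X}\}$ (pairwise distinct states), transition function $\lambda_{\mathbb{X}}(a_i,j)=a_{i-j}$ and output function $\mu_{\mathbb{X}}(a_i,j)=i+j$, for $i,j\in\mathbb{X}$. Each state $a_i$ defines a permutation of $\mathbb{X}^*$, also denoted $a_i$ (acting on the right, $w\mapsto w^{a_i}$), given recursively by $\Lambda^{a_i}=\Lambda$ and $(jw)^{a_i}=(i+j)\,w^{a_{i-j}}$ for $j\in\mathbb{X}$, $w\in\mathbb{X}^*$. The group of the automaton is the group $\mathbb{G}_{\mathbb{X}}=\langle a_i : i\in\mathbb{X}\rangle$ of permutations of $\mathbb{X}^*$ generated by these permutations under composition. The lamplighter group $\mathbb{X}\wr\mathbb{Z}$ is the restricted wreath product, i.e. the semidirect product $\left(\bigoplus_{i\in\mathbb{Z}}\mathbb{X}^{(i)}\right)\rtimes\mathbb{Z}$ with $\mathbb{X}^{(i)}\simeq\mathbb{X}$, where $\mathbb{Z}$ acts on the direct sum by translations of the index set. *)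

(* Defs.v *)
From HB Require Import structures.
From mathcomp Require Import all_boot all_order all_algebra.
From mathcomp Require Import boolp classical_sets functions cardinality.

Set Implicit Arguments.
Unset Strict Implicit.
Unset Printing Implicit Defensive.

Import GRing.Theory.

Local Open Scope ring_scope.
Local Open Scope classical_set_scope.

Section Generated.
Variables (G : groupType) (S : set G).

(* The subgroup generated by S: the intersection of the subgroups containing S. *)
Definition generated : {pred G} := [pred x | `[<
  forall H : {pred G}, group_closed H -> (forall s, S s -> s \in H) -> x \in H
  >]].

Lemma generated_closed : group_closed generated.
Proof.
split=> [|x y /asboolP xS /asboolP yS]; apply/asboolP => H Hgr HS.
  by case: Hgr.
by case: (Hgr) => _; apply; [exact: xS | exact: yS].
Qed.

Record generated_group :=
  Generated { generated_val :> G; _ : generated_val \in generated }.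

HB.instance Definition _ := [isSub for generated_val].
HB.instance Definition _ := [Choice of generated_group by <:].
HB.instance Definition _ := SubChoice_isSubGroup.Build
  G (fun x => x \in generated) generated_group generated_closed.

End Generated.

Definition isomorphic (G H : groupType) : Prop :=
  exists phi : {multiplicative G -> H}, bijective phi.

Section Symmetric.
Variable T : Type.

Record sym := Sym {
  sym_fun :> T -> T;
  sym_inv : T -> T;
  sym_funK : cancel sym_fun sym_inv;
  sym_invK : cancel sym_inv sym_fun
}.

Lemma sym_ext (p q : sym) : p =1 q -> p = q.
Proof.
case: p q => f f' fK f'K [g g' gK g'K] /= /funext efg; subst g.
have efg : f' = g' by apply: funext => x; rewrite -{1}[x]g'K fK.
by subst g'; congr Sym; exact: Prop_irrelevance.
Qed.

HB.instance Definition _ := gen_eqMixin sym.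
HB.instance Definition _ := gen_choiceMixin sym.

Definition sym_one : sym := @Sym id id (fun=> erefl) (fun=> erefl).

(* Permutations act on the right: the left factor is applied first. *)
Definition sym_mul (p q : sym) : sym :=
  Sym (can_comp (sym_funK q) (sym_funK p)) (can_comp (sym_invK p) (sym_invK q)).

Definition sym_invg (p : sym) : sym := Sym (sym_invK p) (sym_funK p).

Fact sym_mulA : associative sym_mul.
Proof. by move=> p q r; exact: sym_ext. Qed.
Fact sym_mul1 : left_id sym_one sym_mul.
Proof. by move=> p; exact: sym_ext. Qed.
Fact sym_mulr1 : right_id sym_one sym_mul.
Proof. by move=> p; exact: sym_ext. Qed.
Fact sym_mulV : left_inverse sym_one sym_invg sym_mul.
Proof. by move=> p; apply: sym_ext => x /=; exact: sym_invK. Qed.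
Fact sym_mulrV : right_inverse sym_one sym_invg sym_mul.
Proof. by move=> p; apply: sym_ext => x /=; exact: sym_funK. Qed.

HB.instance Definition _ :=
  isGroup.Build sym sym_mulA sym_mul1 sym_mulr1 sym_mulV sym_mulrV.

End Symmetric.

Record automaton (A : Type) := Automaton {
  state : Type;
  transition : state -> A -> state;
  output : state -> A -> A
}.

Fixpoint run (A : Type) (M : automaton A) (q : state M) (w : seq A) : seq A :=
  if w is j :: w' then output q j :: run (transition q j) w' else [::].

Section AutomatonGroup.
Variable X : finZmodType.

(* The states a_i are pairwise distinct, so a_i is encoded by its index i. *)
Definition automaton_of : automaton X :=
  @Automaton X X (fun i j => i - j) (fun i j => i + j).

Fixpoint unrun (i : X) (w : seq X) : seq X :=
  if w is k :: w' then (k - i) :: unrun (i - (k - i)) w' else [::].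

Fact runK (i : X) : cancel (@run X automaton_of i) (unrun i).
Proof.
move=> w; elim: w i => //= j w IH i.
by rewrite addrAC subrr add0r IH.
Qed.

Fact unrunK (i : X) : cancel (unrun i) (@run X automaton_of i).
Proof.
move=> w; elim: w i => //= k w IH i.
by rewrite IH addrC subrK.
Qed.

Definition state_perm (i : X) : sym (seq X) := Sym (runK i) (unrunK i).

Definition automaton_group : groupType := generated_group (range state_perm).

End AutomatonGroup.

Section Lamplighter.
Variable X : zmodType.

Definition finite_support : {pred int -> X} :=
  [pred f | `[< finite_set [set k | f k != 0] >]].

Fact finite_support_zmod : zmod_closed finite_support.
Proof.
split=> [|f g /asboolP ff /asboolP fg]; apply/asboolP.
  by apply: (sub_finite_set _ (finite_set0 int)) => k /=; rewrite eqxx.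
apply: (sub_finite_set (B := [set k | f k != 0] `|` [set k | g k != 0])).
  move=> k /=; have [fk0|] := eqVneq (f k) 0; last by left.
  move=> fgk; right; apply: contra_neq fgk => gk0.
  by rewrite -[LHS]/(f k - g k) fk0 gk0 subr0.
by rewrite finite_setU.
Qed.

Record direct_sum :=
  DirectSum { lamps :> int -> X; _ : lamps \in finite_support }.

HB.instance Definition _ := [isSub for lamps].
HB.instance Definition _ := [Choice of direct_sum by <:].
HB.instance Definition _ := GRing.SubChoice_isSubZmodule.Build
  (int -> X) (fun f => f \in finite_support) direct_sum finite_support_zmod.

Fact translate_subproof (m : int) (f : direct_sum) :
  (fun k => f (k - m)) \in finite_support.
Proof.
case: f => f /= /asboolP ff; apply/asboolP.
apply: (sub_finite_set _ (finite_image (fun k => k + m) ff)) => k /= fk.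
by exists (k - m) => //; rewrite subrK.
Qed.

Definition translate (m : int) (f : direct_sum) : direct_sum :=
  DirectSum (translate_subproof m f).

Lemma direct_sum_ext (f g : direct_sum) : f =1 g -> f = g.
Proof. by move=> /funext efg; exact: val_inj. Qed.

Lemma direct_sumD (f g : direct_sum) k : (f + g) k = f k + g k.
Proof. by []. Qed.

Lemma translateD m (f g : direct_sum) :
  translate m (f + g) = translate m f + translate m g.
Proof. exact: direct_sum_ext. Qed.

(* The restricted wreath product of X by int: the semidirect product of the
   direct sum by int, an integer m acting on the direct sum by translate m. *)
Record lamplighter := Lamplighter { lamp_part : direct_sum; shift_part : int }.

HB.instance Definition _ := gen_eqMixin lamplighter.
HB.instance Definition _ := gen_choiceMixin lamplighter.

Definition lamplighter_one := Lamplighter 0 0.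

Definition lamplighter_mul (u v : lamplighter) :=
  Lamplighter (lamp_part u + translate (shift_part u) (lamp_part v))
              (shift_part u + shift_part v).

Definition lamplighter_inv (u : lamplighter) :=
  Lamplighter (translate (- shift_part u) (- lamp_part u)) (- shift_part u).

Fact lamplighter_mulA : associative lamplighter_mul.
Proof.
move=> [f m] [g n] [h p]; congr Lamplighter; last exact: addrA.
rewrite /= translateD addrA; congr (_ + _); apply: direct_sum_ext => k /=.
by rewrite opprD addrA.
Qed.

Fact lamplighter_mul1 : left_id lamplighter_one lamplighter_mul.
Proof.
move=> [f m]; congr Lamplighter; last exact: add0r.
by apply: direct_sum_ext => k; rewrite direct_sumD /= subr0 add0r.
Qed.

Fact lamplighter_mulr1 : right_id lamplighter_one lamplighter_mul.
Proof.
move=> [f m]; congr Lamplighter; last exact: addr0.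
by apply: direct_sum_ext => k; rewrite direct_sumD /= addr0.
Qed.

Fact lamplighter_mulV : left_inverse lamplighter_one lamplighter_inv lamplighter_mul.
Proof.
move=> [f m]; congr Lamplighter; last exact: addNr.
by apply: direct_sum_ext => k; rewrite direct_sumD /= addNr.
Qed.

Fact lamplighter_mulrV : right_inverse lamplighter_one lamplighter_inv lamplighter_mul.
Proof.
move=> [f m]; congr Lamplighter; last exact: subrr.
by apply: direct_sum_ext => k; rewrite direct_sumD /= opprK subrK subrr.
Qed.

HB.instance Definition _ := isGroup.Build lamplighter lamplighter_mulA
  lamplighter_mul1 lamplighter_mulr1 lamplighter_mulV lamplighter_mulrV.

End Lamplighter.

(* Main.v *)
(* On a word read as a power series s over X, the state a_i acts by
   s |-> u s + i v with u = (1 - 2t) / (1 - t) and v = 1 / (1 - t).  Hence a_i is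
   a_0, which is multiplication by u, followed by the translation by the constant
   sequence i, and the group consists of the maps
   s |-> u^m (s + sum_k u^(-k) f_k v), for f in the direct sum and m in Z; these
   compose as the elements (f, m) of the lamplighter group.  Faithfulness comes
   from the independence of the powers of u: the difference operator
   d s = (s_(k+1) - s_k)_k satisfies d u = d - 1 and kills v, so that
   d^n u^i v = 0 for i < n while d^n u^n v = (-1)^n v. *)
From HB Require Import structures.
Require Import Defs.
From mathcomp Require Import all_boot all_order all_algebra.
From mathcomp Require Import boolp classical_sets functions cardinality fsbigop.
From mathcomp Require Import zify.

Set Implicit Arguments.
Unset Strict Implicit.
Unset Printing Implicit Defensive.

Import GRing.Theory.

Local Open Scope ring_scope.

(** * Powers with integer exponents *)

Section IntegerPowers.
Local Open Scope group_scope.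
Variable G : groupType.
Implicit Types (g : G) (m n : int).

Definition zexpg g m : G :=
  match m with Posz n => g ^+ n | Negz n => g ^- n.+1 end.

Lemma zexpgSr g m : zexpg g (m + 1)%R = zexpg g m * g.
Proof.
case: m => n; first by rewrite -expgSr -PoszD addn1.
(* The exponent - n is [Posz 0] for n = 0 and a [Negz] otherwise, whence the final case split. *)
have -> : (Negz n + 1 = - n%:Z)%R by lia.
by rewrite [zexpg g (Negz n)]/= expgS invgM mulgVK; case: n => [|n] //=; rewrite invg1.
Qed.

Lemma zexpgD g m n : zexpg g (m + n)%R = zexpg g m * zexpg g n.
Proof.
elim: n => [|n IH|n IH]; first by rewrite addr0 mulg1.
  by rewrite -addn1 PoszD addrA !zexpgSr IH mulgA.
apply: (mulIg g); rewrite -mulgA -!zexpgSr.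
have -> : (m - n.+1%:Z + 1 = m - n%:Z)%R by lia.
by have -> : (- n.+1%:Z + 1 = - n%:Z)%R by lia.
Qed.

Lemma zexpgN g m : zexpg g (- m)%R = (zexpg g m)^-1.
Proof. by apply: (mulIg (zexpg g m)); rewrite mulVg -zexpgD addNr. Qed.

Lemma zexpg_closed (P : {pred G}) g m :
  group_closed P -> g \in P -> zexpg g m \in P.
Proof.
move=> Pgr gP; have [P1 _] := Pgr.
have gnP (n : nat) : g ^+ n \in P.
  by elim: n => [|n IH] //; rewrite expgS; apply: (group_closedM Pgr).
by case: m => n //=; apply: (group_closedV Pgr).
Qed.

End IntegerPowers.

(** The isomorphism is the inverse of [psi], obtained by choosing preimages; injectivity of [psi]
    carries multiplicativity over to it. *)
Lemma isomorphic_generated (G L : groupType) (S : set G) (psi : L -> G) :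
    {morph psi : x y / (x * y)%g} -> injective psi ->
    (forall x, x \in generated S <-> exists l, psi l = x) ->
  isomorphic (generated_group S) L.
Proof.
move=> psiM psiI psiS.
pose phi (x : generated_group S) : L :=
  projT1 (cid ((psiS (val x)).1 (valP x))).
have phiK x : psi (phi x) = val x by rewrite /phi; case: cid.
have phiM : {morph phi : x y / (x * y)%g}.
  by move=> x y; apply: psiI; rewrite psiM !phiK.
pose phim : {multiplicative _ -> L} :=
  HB.pack phi (isMultiplicative.Build _ _ phi phiM).
exists phim.
have psi_gen l : psi l \in generated S by apply/psiS; exists l.
exists (fun l => Generated (psi_gen l)) => [x|l].
  by apply: val_inj; rewrite /= phiK.
by apply: psiI; rewrite phiK.
Qed.

(** * The automaton on infinite sequences *)

Section Sequences.
Variable X : zmodType.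
Implicit Types (s t : nat -> X) (x : X).

(* The output of the state a_x on the infinite word s. *)
Definition mealy x s (k : nat) : X := x - \sum_(l < k) s l + s k.

(** The state reached from a_0 after k steps, recovered from the output [s]: each letter read is the
    output letter minus the current state. *)
Fixpoint unmealy_state s (k : nat) : X :=
  if k is k'.+1 then unmealy_state s k' - (s k' - unmealy_state s k') else 0.

Definition unmealy s (k : nat) : X := s k - unmealy_state s k.

Lemma mealyK : cancel (mealy 0) unmealy.
Proof.
move=> s; have st k : unmealy_state (mealy 0 s) k = - \sum_(l < k) s l.
  elim: k => [|k IH]; first by rewrite big_ord0 oppr0.
  by rewrite /= IH /mealy sub0r big_ord_recr /= opprK [_ + s k]addrC subrK opprD.
by apply/funext => k; rewrite /unmealy st /mealy sub0r addrAC subrr add0r.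
Qed.

Lemma unmealyK : cancel unmealy (mealy 0).
Proof.
move=> s; have st k : unmealy_state s k = - \sum_(l < k) unmealy s l.
  elim: k => [|k IH]; first by rewrite big_ord0 oppr0.
  by rewrite big_ord_recr [RHS]opprD -IH.
by apply/funext => k; rewrite /mealy sub0r -st /unmealy addrC subrK.
Qed.

Lemma mealyD x y s t : mealy (x + y) (s + t) = mealy x s + mealy y t.
Proof.
apply/funext => k; rewrite /mealy -![(_ + _) k]/(_ k + _ k) big_split /=.
by rewrite opprD (addrACA x) (addrACA (x - _)).
Qed.

Lemma mealy0 x : mealy x 0 = cst x.
Proof. by apply/funext => k; rewrite /mealy big1 // subr0 addr0. Qed.

Definition mealy_sym : sym (nat -> X) := Sym mealyK unmealyK.

Definition additive_syms : {pred sym (nat -> X)} :=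
  [pred u : sym (nat -> X) | `[< {morph sym_fun u : s t / s - t} >]].

Lemma additive_syms_closed : group_closed additive_syms.
Proof.
split=> [|u v /asboolP uD /asboolP vD]; apply/asboolP => s t //=.
apply: (can_inj (sym_funK v)).
by rewrite vD !sym_invK uD.
Qed.

Lemma mealy_pow_additive m : zexpg mealy_sym m \in additive_syms.
Proof.
apply: zexpg_closed; first exact: additive_syms_closed.
apply/asboolP => s t /=; apply: (addIr (mealy 0 t)).
by rewrite -mealyD addr0 !subrK.
Qed.

Definition mealy_pow (m : int) : (nat -> X) -> nat -> X := zexpg mealy_sym m.

Lemma mealy_powB m : {morph mealy_pow m : s t / s - t}.
Proof. exact/asboolP/mealy_pow_additive. Qed.

HB.instance Definition _ m :=
  GRing.isZmodMorphism.Build (nat -> X) (nat -> X) (mealy_pow m) (mealy_powB m).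

Lemma mealy_powDl m n s : mealy_pow (m + n) s = mealy_pow n (mealy_pow m s).
Proof. by rewrite /mealy_pow zexpgD. Qed.

Lemma mealy_pow1 s : mealy_pow 1 s = mealy 0 s. Proof. by []. Qed.

(** * Finite differences and independence of the powers of u *)

Definition fdiff (n : nat) s : nat -> X := iter n (fun s k => s k.+1 - s k) s.

Lemma fdiffSr n s : fdiff n.+1 s = fdiff n (fdiff 1 s).
Proof. exact: iterSr. Qed.

Lemma fdiffB n : {morph fdiff n : s t / s - t}.
Proof.
elim: n => [|n IH] s t //; rewrite /fdiff !iterS -!/(fdiff n _) IH.
apply/funext => k; rewrite -![(_ - _) _]/(_ _ - _ _).
by rewrite !opprD [LHS]addrACA.
Qed.

HB.instance Definition _ n :=
  GRing.isZmodMorphism.Build (nat -> X) (nat -> X) (fdiff n) (fdiffB n).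

Lemma fdiff_cst n x : fdiff n.+1 (cst x) = 0.
Proof.
rewrite fdiffSr -[RHS](raddf0 (fdiff n)); congr fdiff.
by apply/funext => k; exact: subrr.
Qed.

(** The partial sum in [mealy] grows by s_k from index k to k + 1, so differencing reduces it to the
    single term - s_k. *)
Lemma fdiff1_mealy s : fdiff 1 (mealy 0 s) = fdiff 1 s - s.
Proof.
apply/funext => k; rewrite -[RHS]/(s k.+1 - s k - s k) /fdiff /= /mealy !sub0r.
by rewrite big_ord_recr /= !opprD opprK addrACA [X in X + _]addrAC addNr add0r addrC.
Qed.

Lemma fdiffS_mealy_pow n (i : nat) s :
  fdiff n.+1 (mealy_pow i.+1 s) =
  fdiff n.+1 (mealy_pow i s) - fdiff n (mealy_pow i s).
Proof.
rewrite -[i.+1]addn1 PoszD mealy_powDl mealy_pow1 fdiffSr fdiff1_mealy raddfB.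
by rewrite [fdiff n.+1 _]fdiffSr.
Qed.

(** Double induction: [fdiffS_mealy_pow] reduces the pair (n + 1, i + 1) to (n + 1, i) and (n,
    i). *)
Lemma fdiff_mealy_pow_lt n (i : nat) x :
  (i < n)%N -> fdiff n (mealy_pow i (cst x)) = 0.
Proof.
elim: n i => // n IHn; elim=> [|i IHi] lt_in; first exact: fdiff_cst.
by rewrite fdiffS_mealy_pow IHi 1?ltnW// IHn// subr0.
Qed.

(** Each step strips one difference and one power at the cost of a sign, until the constant [x] is
    left. *)
Lemma fdiff_mealy_pow_eq0 (n : nat) x :
  fdiff n (mealy_pow n (cst x)) = 0 -> x = 0.
Proof.
elim: n => [/(congr1 (fun s => s 0%N))//|n IH].
rewrite fdiffS_mealy_pow fdiff_mealy_pow_lt// sub0r => /eqP.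
by rewrite oppr_eq0 => /eqP.
Qed.

Lemma mealy_pow_free n (c : nat -> X) :
    \sum_(i < n) mealy_pow i (cst (c i)) = 0 ->
  forall i, (i < n)%N -> c i = 0.
Proof.
elim: n => // n IH; rewrite big_ord_recr /= => sum0.
have cn0 : c n = 0.
  move: sum0 => /(congr1 (fdiff n)); rewrite raddfD raddf_sum raddf0 big1.
    by rewrite add0r => /fdiff_mealy_pow_eq0.
  by move=> i _; exact: fdiff_mealy_pow_lt.
move: sum0; rewrite cn0 (raddf0 (mealy_pow n)) addr0 => /IH c0 i.
by rewrite ltnS leq_eqVlt => /predU1P[->|/c0].
Qed.

(** * Lamp configurations as sequences *)

Local Open Scope classical_set_scope.

(** The sign of the exponent is dictated by the product of the lamplighter group: moving a
    translation leftwards past the m-th power of a_0 applies u^(-m), which must match a shift of the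
    lamps by m. *)
Definition lamp_seq (f : direct_sum X) : nat -> X :=
  \sum_(k \in [set: int]) mealy_pow (- k) (cst (f k)).

Lemma lamp_seqE (r : seq int) (f : direct_sum X) :
    uniq r -> (forall k, k \notin r -> f k = 0) ->
  lamp_seq f = \sum_(k <- r) mealy_pow (- k) (cst (f k)).
Proof.
move=> r_uniq fr; rewrite /lamp_seq (fsbigE r)//.
  by apply: eq_bigl => k; exact: in_setT.
by move=> k _ /fr ->; exact: raddf0.
Qed.

(** Descending order is chosen so that, after applying u^N, the i-th entry carries the exponent
    i. *)
Definition window (N : nat) : seq int := [seq N%:Z - i%:Z | i <- iota 0 N.*2.+1].

Lemma window_uniq N : uniq (window N).
Proof. by rewrite map_inj_uniq ?iota_uniq// => i j; lia. Qed.

Lemma mem_window N k : (k \in window N) = (`|k| <= N)%N.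
Proof.
apply/mapP/idP => [[i]|kN]; first by rewrite mem_iota; lia.
by exists `|N%:Z - k|%N; rewrite ?mem_iota; lia.
Qed.

(** The bound serves all larger windows too, so that two configurations can share one. *)
Lemma direct_sum_bounded (f : direct_sum X) :
  exists N, forall M, (N <= M)%N -> forall k, k \notin window M -> f k = 0.
Proof.
case: f => f /= /asboolP/finite_seqP[r fr].
exists (\max_(k <- r) `|k|)%N => M leM k; rewrite mem_window.
apply: contraNeq => fk; apply: leq_trans leM.
have kr : k \in r by have : [set` r] k by rewrite -fr.
exact: leq_bigmax_seq kr isT.
Qed.

Lemma lamp_seqD : {morph lamp_seq : f g / f + g}.
Proof.
move=> f g; have [N fN] := direct_sum_bounded f.
have [N' gN'] := direct_sum_bounded g; set M := maxn N N'.
have {}fN := fN M (leq_maxl _ _); have {}gN' := gN' M (leq_maxr _ _).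
rewrite !(lamp_seqE (window_uniq M))//; last first.
  by move=> k kM; rewrite direct_sumD fN// gN'// addr0.
by rewrite -big_split; apply: eq_bigr => k _ /=; rewrite -raddfD.
Qed.

Lemma lamp_seq_translate m f :
  lamp_seq (translate m f) = mealy_pow (- m) (lamp_seq f).
Proof.
have [N fN] := direct_sum_bounded f; have {}fN := fN N (leqnn N).
rewrite (lamp_seqE (window_uniq N) fN).
(* The list moves along with the lamps, since [window N] may miss part of the translated support. *)
rewrite (@lamp_seqE [seq k + m | k <- window N])
  ?(map_inj_uniq (addIr m)) ?window_uniq//.
  rewrite big_map raddf_sum; apply: eq_bigr => k _ /=.
  by rewrite addrK opprD mealy_powDl.
move=> k kN /=; apply: fN; apply: contra kN => kN.
by apply/mapP; exists (k - m); rewrite ?subrK.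
Qed.

Lemma lamp_seq_eq0 f : lamp_seq f = 0 -> f = 0.
Proof.
have [N fN] := direct_sum_bounded f; have {}fN := fN N (leqnn N).
(* Applying u^N makes all exponents nonnegative, as [mealy_pow_free] requires. *)
rewrite (lamp_seqE (window_uniq N) fN) => /(congr1 (mealy_pow N)).
rewrite raddf0 raddf_sum big_map => sum0.
apply: direct_sum_ext => k; have [|/fN//] := boolP (k \in window N).
move=> /mapP[i]; rewrite mem_iota => /= i_lt ->.
apply: (mealy_pow_free (c := fun i : nat => f (N%:Z - i%:Z)) _ i_lt).
rewrite -[RHS]sum0 
  -(big_mkord xpredT (fun i : nat => mealy_pow i (cst (f (N%:Z - i%:Z))))).
rewrite /index_iota subn0; apply: eq_bigr => j _.
by rewrite /= -mealy_powDl; congr mealy_pow; lia.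
Qed.

Lemma lamp_seq_inj : injective lamp_seq.
Proof.
move=> f g fg; apply/eqP; rewrite -subr_eq0; apply/eqP/lamp_seq_eq0.
by apply: (addIr (lamp_seq g)); rewrite -lamp_seqD subrK add0r.
Qed.

Fact lamp_subproof (k : int) x :
  (fun j => if j == k then x else 0) \in @Defs.finite_support X.
Proof.
apply/asboolP; apply: (sub_finite_set _ (finite_set1 k)) => j /=.
by case: (j =P k); rewrite ?eqxx.
Qed.

Definition lamp (k : int) x : direct_sum X := DirectSum (lamp_subproof k x).

Lemma lamp_seq_lamp k x : lamp_seq (lamp k x) = mealy_pow (- k) (cst x).
Proof.
rewrite (@lamp_seqE [:: k])//; first by rewrite big_seq1 /= eqxx.
by move=> j; rewrite inE /= => /negPf ->.
Qed.

End Sequences.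

(** * Translations and states acting on finite words *)

Section Words.
Variable X : finZmodType.
Implicit Types (s t : nat -> X) (w : seq X).

Fixpoint addw s w : seq X :=
  if w is j :: w' then (j + s 0%N) :: addw (fun k => s k.+1) w' else [::].

Lemma addwD s t w : addw (s + t) w = addw t (addw s w).
Proof.
elim: w s t => //= j w IH s t; rewrite -addrA; congr (_ :: _).
exact: (IH (fun k => s k.+1) (fun k => t k.+1)).
Qed.

Lemma addw0 w : addw 0 w = w.
Proof. by elim: w => //= j w {2}<-; rewrite addr0. Qed.

Lemma addwK s : cancel (addw s) (addw (- s)).
Proof. by move=> w; rewrite -addwD subrr addw0. Qed.

Lemma addwNK s : cancel (addw (- s)) (addw s).
Proof. by move=> w; rewrite -addwD addNr addw0. Qed.

Lemma addw_nseq0 s n : addw s (nseq n 0) = mkseq s n.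
Proof.
by elim: n s => //= n IH s; rewrite IH add0r /mkseq /= (iotaDl 1 0) -map_comp.
Qed.

(** The automaton is additive jointly in state and input: reading j + s_0 in state x + y leads to (x
    - s_0) + (y - j), the sum of the states of two separate runs. *)
Lemma run_addw x y s w :
  run (M := automaton_of X) (x + y) (addw s w) =
  addw (mealy x s) (run (M := automaton_of X) y w).
Proof.
elim: w x y s => //= j w IH x y s; congr (_ :: _).
  by rewrite /mealy big_ord0 subr0 [x + y]addrC addrACA.
have -> : x + y - (j + s 0%N) = (x - s 0%N) + (y - j).
  by rewrite opprD [- j - _]addrC addrACA.
rewrite IH; congr addw; apply/funext => k; rewrite /mealy big_ord_recl.
by rewrite opprD addrA.
Qed.

Definition translation s : sym (seq X) := Sym (addwK s) (addwNK s).

Local Notation a := (@state_perm X).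

Lemma translationD s t : translation (s + t) = (translation s * translation t)%g.
Proof. by apply: sym_ext => w; exact: addwD. Qed.

Lemma translation0 : translation 0 = 1%g.
Proof. by apply: sym_ext => w; exact: addw0. Qed.

(** This is [run_addw] with the zero sequence added, on which the state x outputs the constant x. *)
Lemma state_permE x : a x = (a 0 * translation (cst x))%g.
Proof.
by apply: sym_ext => w; rewrite /= -(mealy0 x) -run_addw addr0 addw0.
Qed.

Lemma translation_state_pow s m :
  (translation s * zexpg (a 0) m = zexpg (a 0) m * translation (mealy_pow m s))%g.
Proof.
have nonneg (n : nat) t :
    (translation t * zexpg (a 0) n = zexpg (a 0) n * translation (mealy_pow n t))%g.
  elim: n => [|n IH]; first by rewrite mulg1 mul1g.
  rewrite -addn1 PoszD mealy_powDl zexpgSr mulgA IH -!mulgA; congr (_ * _)%g.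
  apply: sym_ext => w /=; rewrite -[X in run X (addw _ _)](addr0 0).
  exact: run_addw.
case: m => n; first exact: nonneg.
rewrite NegzE; set t := mealy_pow _ s.
(* Writing s as u^(n+1) t turns the claim for a negative power into the one for its inverse. *)
have -> : s = mealy_pow n.+1 t by rewrite -mealy_powDl addNr.
apply: (mulgI (zexpg (a 0) n.+1)); rewrite !mulgA -zexpgD subrr mul1g.
by rewrite -nonneg -mulgA -zexpgD subrr mulg1.
Qed.

Lemma state_pow_nseq0 m n : zexpg (a 0) m (nseq n 0) = nseq n 0.
Proof.
pose P : {pred sym (seq X)} :=
  [pred g : sym (seq X) | `[< sym_fun g (nseq n 0) = nseq n 0 >]].
apply/asboolP; apply: (@zexpg_closed _ P).
  split=> [|g h /asboolP g0 /asboolP h0]; apply/asboolP => //=.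
  by rewrite g0 -{1}h0 sym_funK.
apply/asboolP; rewrite /= {P}; elim: n => //= n {2}<-.
by rewrite addr0 subr0.
Qed.

(** Powers of [a 0] fix the zero words, while a translation writes its own sequence on them; so only
    the trivial translation is a power of [a 0]. *)
Lemma translation_inj_mod s m n :
    (translation s * zexpg (a 0) m = zexpg (a 0) n)%g -> s = 0.
Proof.
move=> eq_sm; apply/funext => k; have: (translation s = zexpg (a 0) (n - m))%g.
  by rewrite zexpgD zexpgN -eq_sm mulgK.
(* Length k + 1 is the shortest that displays the entry of index k. *)
move=> ts; have: addw s (nseq k.+1 0) = nseq k.+1 0.
  by rewrite -[LHS]/(translation s _) ts state_pow_nseq0.
by move=> /(congr1 (nth 0 ^~ k)); rewrite addw_nseq0 nth_mkseq// nth_nseq ltnSn.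
Qed.

(** * The lamplighter group inside the permutations of words *)

Definition lamplighter_perm (l : lamplighter X) : sym (seq X) :=
  (translation (lamp_seq (lamp_part l)) * zexpg (a 0) (shift_part l))%g.

Lemma lamplighter_permM : {morph lamplighter_perm : l l' / (l * l')%g}.
Proof.
move=> [f m] [g n]; rewrite /lamplighter_perm /= lamp_seqD lamp_seq_translate.
rewrite translationD zexpgD -!mulgA; congr (_ * _)%g; rewrite !mulgA.
by rewrite translation_state_pow -mealy_powDl addNr.
Qed.

Lemma translation_inj : injective translation.
Proof.
move=> s t st; apply/eqP; rewrite -subr_eq0; apply/eqP.
apply: (@translation_inj_mod _ 0 0); rewrite mulg1.
by rewrite translationD st -translationD subrr translation0.
Qed.

Lemma lamplighter_perm_inj : (2 <= #|X|)%N -> injective lamplighter_perm.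
Proof.
move=> X_ge2 [f m] [g n]; rewrite /lamplighter_perm /= => eq_fg.
have fg : f = g.
  apply: lamp_seq_inj; apply/eqP; rewrite -subr_eq0; apply/eqP.
  apply: (@translation_inj_mod _ m n).
  rewrite addrC translationD -mulgA eq_fg mulgA -translationD addNr.
  by rewrite translation0 mul1g.
rewrite -{}fg in eq_fg *; congr Lamplighter.
have amn : zexpg (a 0) m = zexpg (a 0) n by exact: mulgI eq_fg.
have [x x_neq0] : exists x : X, x != 0.
  have /card_gt1P[x [y [_ _ xy]]] := X_ge2.
  have [x0|] := eqVneq x 0; last by exists x.
  by exists y; rewrite -x0 eq_sym.
(* Equal powers of [a 0] conjugate the translation by the constant x in the same way, so u^m x v =
   u^n x v; since x is nonzero, the lit lamp reveals its position. *)
have : lamp (- m) x = lamp (- n) x.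
  apply/lamp_seq_inj/translation_inj; rewrite !lamp_seq_lamp !opprK.
  apply: (mulgI (zexpg (a 0) m)).
  by rewrite -translation_state_pow amn translation_state_pow.
move=> /(congr1 (fun h : direct_sum X => h (- m))) /=; rewrite eqxx.
by case: eqP => [/oppr_inj|_ x0] //; rewrite x0 eqxx in x_neq0.
Qed.


Lemma generated_lamplighter_perm g :
  g \in generated (range a) <-> exists l, lamplighter_perm l = g.
Proof.
split=> [/asboolP gen|[[f m] <-]].
  pose P : {pred sym (seq X)} :=
    [pred g : sym (seq X) | `[< exists l, lamplighter_perm l = g >]].
  apply/asboolP; apply: (gen P) => [|_ [x _ <-]].
    split=> [|_ _ /asboolP[l <-] /asboolP[l' <-]]; apply/asboolP.
      exists 1%g; apply: (mulgI (lamplighter_perm 1%g)).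
      by rewrite -lamplighter_permM !mulg1.
    exists (l / l')%g; apply: (mulIg (lamplighter_perm l')).
    by rewrite -lamplighter_permM !mulgVK.
  (* The state a_x is [a 0] followed by the constant x; moved to the left of [a 0], this constant
     becomes u^(-1) x v, a lamp at position 1. *)
  apply/asboolP; exists (Lamplighter (lamp 1 x) 1).
  rewrite /lamplighter_perm [lamp_part _]/= [shift_part _]/= lamp_seq_lamp.
  by rewrite translation_state_pow -mealy_powDl addNr [RHS]state_permE.
apply/asboolP => H Hgr aH; have HM := group_closedM Hgr.
have HV := group_closedV Hgr.
have aP x : a x \in H by apply: aH; exists x.
have aXP k : zexpg (a 0) k \in H by exact: zexpg_closed.
apply: (HM) => //; rewrite /lamp_seq.
apply: (big_ind (fun s => translation s \in H)).
- by rewrite translation0; case: Hgr.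
- by move=> s t sH tH; rewrite translationD; exact: HM.
move=> k _.
(* The product of the inverse of [a 0] with [a (f k)] is the translation by a constant, and
   conjugation by a power of [a 0] supplies u^(-k). *)
have -> : translation (mealy_pow (- k) (cst (f k))) =
    ((zexpg (a 0) (- k))^-1 * (((a 0)^-1 * a (f k)) * zexpg (a 0) (- k)))%g.
  by rewrite (state_permE (f k)) mulKg translation_state_pow mulKg.
by do ![apply: (HM) | apply: (HV)].
Qed.

End Words.

Theorem theorem2 (X : finZmodType) (X_ge2 : (2 <= #|X|)%N) :
  isomorphic (automaton_group X) (lamplighter X).
Proof.
apply: (isomorphic_generated (@lamplighter_permM X)).
  exact: lamplighter_perm_inj.
exact: generated_lamplighter_perm.
Qed.
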